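(* For any group $G$ and any bounded $G$-lattice $X$ we have $p_X(a)\ge\bar u_X(a)$ for all $a\in X$.
   Context: A lattice is a set $X$ with commutative, associative, idempotent operations $\vee,\wedge$ satisfying the absorption laws, ordered by $x\le y$ iff $x\wedge y=x$; bounded means there are least and greatest elements $\mathbf 0\ne\mathbf 1$. A $G$-lattice is a lattice with an action of the group $G$ by lattice automorphisms. $\Delta(a)=\{g\in G:ga\wedge a\ne\mathbf 0\}$; for nonempty $D\subset G$, $\operatorname{lar}(D)=\min\{|F|:F\subset G,\ G=FD\}$, and $\operatorname{lar}(\emptyset)$ is the smallest infinite cardinal greater than $|G|$. $p_X(a)=1/\operatorname{lar}(\Delta(a))$ if $0<\operatorname{lar}(\Delta(a))<\omega$, else $p_X(a)=0$. A measure on $X$ is a function $\mu:X\to[0,1]$ that is monotone ($a\le b\Rightarrow\mu(a)\le\mu(b)$), has $\mu(\mathbf 0)=0$, $\mu(\mathbf 1)=1$, is subadditive ($\mu(a\vee b)\le\mu(a)+\mu(b)$) and additive ($\mu(a_1\vee\dots\vee a_n)=\sum\mu(a_i)$ whenever $a_i\wedge a_j=\mathbf 0$ for $i\ne j$); it need not be $G$-invariant. The upper Banach density is $\bar u_X(a)=\sup_\mu\inf_{g\in G}\mu(ga)$, the supremum over all measures $\mu$ on $X$; if $X$ has no measure, $\bar u_X(\mathbf 1)=1$ and $\bar u_X(a)=0$ for $a\ne\mathbf 1$. *)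

(* Defs.v *)
From mathcomp Require Import all_boot all_order all_algebra.
From mathcomp Require Import all_classical all_reals.

Set Implicit Arguments.
Unset Strict Implicit.
Unset Printing Implicit Defensive.

Import Order.TTheory GRing.Theory Num.Theory.

Local Open Scope classical_set_scope.
Local Open Scope card_scope.
Local Open Scope ring_scope.

(* [groupType] allows infinite groups. Each [act g] is a bijection, with
   inverse [act g^-1], so it is a lattice automorphism. *)
Record is_lattice_action (G : groupType) (d : Order.disp_t) (X : latticeType d)
    (act : G -> X -> X) : Prop := IsLatticeAction {
  act_one : forall x, act 1%g x = x;
  act_mul : forall g h x, act (g * h)%g x = act g (act h x);
  act_meet : forall g x y, act g (x `&` y)%O = (act g x `&` act g y)%O;
  act_join : forall g x y, act g (x `|` y)%O = (act g x `|` act g y)%O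
}.

Definition card_lt T U (A : set T) (B : set U) : Prop :=
  (A #<= B) /\ ~ (B #<= A).

Definition covers_by (G : groupType) (F D : set G) : Prop :=
  [set (f * x)%g | f in F & x in D] = [set: G].

(* A cardinal is represented by any set of that cardinality:
   [is_lar D K] means that lar D is the cardinal |K|. *)
Definition is_lar (G : groupType) (D : set G) (U : Type) (K : set U) : Prop :=
  (D !=set0 ->
     (exists F : set G, covers_by F D /\ F #= K) /\
     (forall F : set G, covers_by F D -> K #<= F)) /\
  (D = set0 ->
     [/\ infinite_set K, card_lt [set: G] K &
         forall (V : Type) (L : set V),
           infinite_set L -> card_lt [set: G] L -> K #<= L]).

Definition Delta (G : groupType) (d : Order.disp_t) (X : tbLatticeType d)
    (act : G -> X -> X) (a : X) : set G :=
  [set g | (act g a `&` a)%O <> \bot%O].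

Definition p_density (R : realType) (G : groupType) (d : Order.disp_t)
    (X : tbLatticeType d) (act : G -> X -> X) (a : X) : R :=
  match pselect (exists n : nat, (0 < n)%N /\ is_lar (Delta act a) `I_n) with
  | left h => (sval (cid h))%:R^-1
  | right _ => 0
  end.

Record is_measure (R : realType) (d : Order.disp_t) (X : tbLatticeType d)
    (mu : X -> R) : Prop := IsMeasure {
  measure_range : forall a, 0 <= mu a <= 1;
  measure_mono : forall a b : X, (a <= b)%O -> mu a <= mu b;
  measure_bot : mu \bot%O = 0;
  measure_top : mu \top%O = 1;
  measure_subadd : forall a b : X, mu (a `|` b)%O <= mu a + mu b;
  measure_add : forall (n : nat) (a : 'I_n -> X),
    (forall i j, i != j -> (a i `&` a j)%O = \bot%O) ->
    mu (\join_(i < n) a i)%O = \sum_(i < n) mu (a i)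
}.

Definition upper_banach (R : realType) (G : groupType) (d : Order.disp_t)
    (X : tbLatticeType d) (act : G -> X -> X) (a : X) : R :=
  if `[< exists mu : X -> R, is_measure mu >] then
    sup [set inf (range (fun g => mu (act g a))) | mu in @is_measure R d X]
  else if a == \top%O then 1 else 0.

(* Main.v *)
Require Import Defs.
From mathcomp Require Import all_boot all_order all_algebra.
From mathcomp Require Import all_classical all_reals.
Set Implicit Arguments.
Unset Strict Implicit.
Import Order.TTheory GRing.Theory Num.Theory.
Local Open Scope ring_scope.

(** Fix a measure [mu] and let [c] be the infimum of [mu] over the orbit of [a].
If [c > 0], a family of pairwise disjoint translates of [a] has at most [1 / c]
members, by additivity; choose one of maximal size [n], say [g_1 a, ..., g_n a].
By maximality every translate [g a] meets some [g_i a], that is, [g_i^-1 g] lies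
in [Delta a].  So [n] translates of [Delta a] cover [G], and
[p a >= 1 / n >= c]. *)

Local Open Scope classical_set_scope.
Local Open Scope card_scope.

Lemma cover_set1 (G : groupType) : covers_by [set 1%g] [set: G].
Proof.
apply/seteqP; split=> // g _; exists 1%g => //; exists g => //.
by rewrite mul1g.
Qed.

Lemma covers_by_nonempty (G : groupType) (F D : set G) :
  covers_by F D -> F !=set0 /\ D !=set0.
Proof.
move=> FD; have : [set: G] 1%g by [].
by rewrite -FD => -[f Ff [x Dx _]]; split; [exists f | exists x].
Qed.

Lemma is_lar_le (G : groupType) (F D : set G) (m n : nat) :
  is_lar D `I_m -> covers_by F D -> F #<= `I_n -> (m <= n)%N.
Proof.
move=> [larD _] FD Fn; have [_ D0] := covers_by_nonempty FD.
have [_ /(_ F FD) mF] := larD D0.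
by rewrite -card_le_II; exact: card_le_trans mF Fn.
Qed.

(** The least size [m] of a finite cover is the larity: any infinite cover dominates [nat], hence
    [I_m]. It is positive because the empty set covers nothing. *)
Lemma is_lar_exists (G : groupType) (F D : set G) (n : nat) :
  covers_by F D -> F #<= `I_n -> exists m, (0 < m)%N /\ is_lar D `I_m.
Proof.
move=> FD Fn; have [_ D0] := covers_by_nonempty FD.
pose P m := `[< exists E : set G, covers_by E D /\ E #= `I_m >].
have exP : exists m, P m.
  have /finite_setP[k Fk] : finite_set F := card_le_finite Fn (finite_II n).
  by exists k; apply/asboolP; exists F.
case: (ex_minnP exP) => m /asboolP[E [ED Em]] min_m.
exists m; split.
  rewrite lt0n; apply/eqP => m0; move: Em; rewrite m0 II0 card_eq0 => /eqP E0.
  by have [[x]] := covers_by_nonempty ED; rewrite E0.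
split=> [_|D_eq0]; last by case: D0 => x; rewrite D_eq0.
split=> [|E' E'D]; first by exists E.
have [/finite_setP[k E'k]|/infiniteP natE'] := pselect (finite_set E').
  have mk : (m <= k)%N by apply: min_m; apply/asboolP; exists E'.
  by rewrite (card_le_eqr E'k) card_le_II.
by apply: card_le_trans natE'; apply: subset_card_le.
Qed.

Section Density.
Context (R : realType) (G : groupType) (d : Order.disp_t) (X : tbLatticeType d).
Context (act : G -> X -> X).

Lemma p_density_ge0 (a : X) : 0 <= p_density R act a.
Proof. by rewrite /p_density; case: pselect => // h; rewrite invr_ge0. Qed.

Lemma le_p_density (a : X) (F : set G) (n : nat) :
  covers_by F (Delta act a) -> F #<= `I_n -> n%:R^-1 <= p_density R act a.
Proof.
(* A finite cover excludes the default value 0. *)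
move=> FD Fn; rewrite /p_density; case: pselect => [h|[]]; last first.
  exact: is_lar_exists FD Fn.
case: (cid h) => m /= [m0 larm].
have mn := is_lar_le larm FD Fn.
by rewrite lef_pV2 ?posrE ?ltr0n ?ler_nat // (leq_trans m0 mn).
Qed.

Hypothesis hact : is_lattice_action act.

Lemma act_le (g : G) (x y : X) : (x <= y)%O -> (act g x <= act g y)%O.
Proof. by rewrite !leEmeet -(act_meet hact) => /eqP ->. Qed.

Lemma act_bot (g : G) : act g \bot%O = \bot%O.
Proof.
(* Reduces to applying [act g] to [\bot <= act g^-1 \bot]. *)
apply/eqP; rewrite -lex0 -[leRHS](act_one hact) -(mulgV g) (act_mul hact).
exact/act_le/le0x.
Qed.

Lemma act_top (g : G) : act g \top%O = \top%O.
Proof.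
apply/eqP; rewrite -le1x -[leLHS](act_one hact) -(mulgV g) (act_mul hact).
exact/act_le/lex1.
Qed.

(** Settles the case where [X] has no measure and the upper density of [\top] is 1 by convention. As
    [\top] is fixed and nonzero, its [Delta] is all of [G], covered by one translate. *)
Lemma p_density_top : (\bot : X)%O <> \top%O ->
  1 <= p_density R act (\top%O : X).
Proof.
move=> bot_neq_top; rewrite -invr1; apply: (@le_p_density _ [set 1%g] 1); last first.
  by have := @card_set1 G 1%g; rewrite card_eq_le => /andP[].
suff -> : Delta act (\top%O : X) = [set: G] by exact: cover_set1.
by apply/seteqP; split=> // g _; rewrite /Delta/= act_top meetxx => /esym.
Qed.

(** The meet of [act g a] and [act h a] is the image under [act g] of the meet of [a] and
    [act (g^-1 * h) a], and [act g] fixes [\bot]. *)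
Lemma Delta_mulVg (a : X) (g h : G) :
  (act g a `&` act h a)%O <> \bot%O -> Delta act a (g^-1 * h)%g.
Proof.
move=> gh; rewrite /Delta/= => e; apply: gh.
rewrite -[h](mulVKg g) (act_mul hact) -(act_meet hact) meetC e.
exact: act_bot.
Qed.

Let disj (a : X) : rel G := fun g h => (act g a `&` act h a)%O == \bot%O.

Section Packing.
Context (a : X) (mu : X -> R) (c : R).
Hypothesis mu_measure : is_measure mu.
Hypothesis c_le : forall g, c <= mu (act g a).

Lemma packing_bound (s : seq G) : pairwise (disj a) s -> c *+ size s <= 1.
Proof.
move=> /(pairwiseP 1%g) s_disj.
pose b (i : 'I_(size s)) := act (nth 1%g s i) a.
have /andP[_] := measure_range mu_measure (\join_(i < size s) b i)%O.
apply: le_trans.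
rewrite (measure_add mu_measure); last first.
  (* [pairwise] only speaks of increasing indices; the other order follows by commutativity of the
     meet. *)
  move=> i j; rewrite -val_eqE neq_ltn => /orP[] ij.
    by apply/eqP/s_disj => //; rewrite inE.
  by rewrite meetC; apply/eqP/s_disj => //; rewrite inE.
rewrite -[X in c *+ X]card_ord -sumr_const.
by apply: ler_sum => i _; exact: c_le.
Qed.

Lemma maximal_packing : 0 < c ->
  exists2 s, pairwise (disj a) s & forall g, ~~ all (disj a g) s.
Proof.
move=> c0; pose P n := `[< exists2 s, pairwise (disj a) s & size s = n >].
have exP : exists n, P n by exists 0%N; apply/asboolP; exists [::].
have ubP n : P n -> (n <= Num.truncn c^-1)%N.
  (* Since [c > 0], [c *+ n <= 1] gives [n <= c^-1], so the integer part of [c^-1] bounds [n]. *)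
  move=> /asboolP[s /packing_bound + <-].
  by rewrite -mulr_natl -ler_pdivlMr // mul1r truncn_ge_nat // invr_ge0 ltW.
case: (ex_maxnP exP ubP) => n /asboolP[s s_disj <-] max_s.
exists s => // g; apply/negP => gs.
have /max_s : P (size (g :: s)).
  by apply/asboolP; exists (g :: s) => //=; rewrite gs.
by rewrite ltnn.
Qed.

Lemma le_p_density_measure : 0 < c -> c <= p_density R act a.
Proof.
move=> c0; have [s s_disj s_max] := maximal_packing c0.
(* The empty packing is not maximal, as [all] holds on it vacuously. *)
have s0 : (0 < size s)%N by have := s_max 1%g; case: (s).
apply: (@le_trans _ _ (size s)%:R^-1).
  have := packing_bound s_disj.
  by rewrite -[c *+ _]mulr_natr -ler_pdivlMr ?ltr0n// mul1r.
apply: (@le_p_density _ [set` s]).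
  apply/seteqP; split=> // g _.
  have /allPn[h hs gh] := s_max g.
  exists h => //; exists (h^-1 * g)%g; last exact: mulVKg.
  by apply: Delta_mulVg; rewrite meetC; apply/eqP.
(* The members of [s] are values of [nth] at indices below [size s]. *)
apply: card_le_trans (card_image_le (nth 1%g s) `I_(size s)).
apply: subset_card_le => g /= /(nthP 1%g)[i i_s <-].
by exists i.
Qed.

End Packing.

Lemma inf_orbit_le_p_density (a : X) (mu : X -> R) : is_measure mu ->
  inf (range (fun g => mu (act g a))) <= p_density R act a.
Proof.
move=> mu_measure; set c := inf _.
have [c0|] := leP c 0; first exact: le_trans c0 (p_density_ge0 a).
apply: (le_p_density_measure mu_measure) => g.
apply: ge_inf; last by exists g.
(* The bound 0 makes [inf] a genuine lower bound of the orbit values. *)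
by exists 0 => _ [h _ <-]; case/andP: (measure_range mu_measure (act h a)).
Qed.

End Density.

Theorem theorem1p7 (R : realType) (G : groupType) (d : Order.disp_t)
    (X : tbLatticeType d) (act : G -> X -> X)
    (bot_neq_top : (\bot : X)%O <> \top%O) (hact : is_lattice_action act)
    (a : X) :
  p_density R act a >= upper_banach R act a.
Proof.
rewrite /upper_banach; case: asboolP => [[mu mu_measure]|_].
  (* A bound on every element bounds the [sup] once the set is nonempty, which [mu] witnesses. *)
  apply: ge_sup; first by exists (inf (range (fun g => mu (act g a)))), mu.
  by move=> _ [nu nu_measure <-]; exact: inf_orbit_le_p_density.
case: eqP => [->|_]; first exact: p_density_top.
exact: p_density_ge0.
Qed.
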